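(* Let $B(t)=\sum_{n\ge1}B_n\frac{t^n}{n!}\in\mathbb{C}[[t]]$ with $B_1\ne0$. The umbral shift attached to $B$, $D_{B}:\mathbb{C}[x] \rightarrow \mathbb{C}[x]$, is the unique linear map satisfying $$D_{B} \circ \phi_{B} \circ L(-1)^{n}y =\phi_{B} \circ L(-1)^{n+1}y$$ for all $n \geq 0$.
   Context: The umbral shift $D_B$ attached to $B$ is by definition the unique linear map $\mathbb{C}[x]\to\mathbb{C}[x]$ satisfying $D_{B}e^{xB(w)}=\frac{\partial}{\partial w}e^{xB(w)}$, where operators on $\mathbb{C}[x]$ act coefficientwise on power series in $w$ and $e^{xB(w)}=\sum_{n\ge0}x^nB(w)^n/n!$. On the space $y\mathbb{C}[x_1,x_2,x_3,\dots]$ ($y,x_1,x_2,\dots$ commuting formal variables) define operators $h(n)$, $n\in\mathbb{Z}$: $h(n)=\frac{1}{(-n-1)!}x_{-n}$ (multiplication) for $n<0$; $h(n)=n!\frac{\partial}{\partial x_n}$ for $n>0$; $h(0)=y\frac{\partial}{\partial y}$ (the identity operator on this space). Set $L(-1)=\frac12\sum_{k\in\mathbb{Z}}h(-1-k)h(k)$; this is one of the operators $L(n)$ of the standard quadratic representation of the Virasoro algebra of central charge $1$, and it equals $x_1y\frac{\partial}{\partial y}+\sum_{k\ge1}x_{k+1}\frac{\partial}{\partial x_k}$. $\phi_B:y\mathbb{C}[x_1,x_2,\dots]\to\mathbb{C}[x]$ is the substitution map (restriction of an algebra homomorphism) with $x_j\mapsto B_jx$ ($j\ge1$) and $y\mapsto1$.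 *)

(* Defs.v *)
From mathcomp Require Import all_boot all_order all_algebra.
From mathcomp Require Import finmap.
From mathcomp Require Import boolp classical_sets functions cardinality fsbigop.
From mathcomp Require Import monalg.

Set Implicit Arguments.
Unset Strict Implicit.
Unset Printing Implicit Defensive.

Import GRing.Theory.
Local Open Scope ring_scope.

(* Formal power series over A are represented by their coefficient sequences  *)
(* f : nat -> A, with f n the coefficient of w^n.                             *)
Section Series.
Variable A : pzRingType.

Definition fps_one : nat -> A := fun n => (n == 0)%:R.

Definition fps_mul (f g : nat -> A) : nat -> A :=
  fun n => \sum_(i < n.+1) f i * g (n - i)%N.

Definition fps_exp (f : nat -> A) (k : nat) : nat -> A :=
  iter k (fps_mul f) fps_one.

Definition fps_deriv (f : nat -> A) : nat -> A := fun n => f n.+1 *+ n.+1.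

End Series.

Section UmbralShift.
Variables (F : fieldType) (B : nat -> F).

(* B(w) = \sum_(n >= 1) B_n w^n / n!; the value B 0 is not used.              *)
Definition Bser : nat -> F := fun n => if n is 0 then 0 else B n / n`!%:R.

(* e^{x B(w)} in F[x][[w]].  The sum over k is finite, as B(w)^k has no term  *)
(* of degree less than k; \sum_(k \in setT) is a sum over the finite support. *)
Definition exp_xB : nat -> {poly F} :=
  fun n => \sum_(k \in [set: nat]) (fps_exp Bser k n / k`!%:R) *: 'X^k.

(* D is linear and D e^{x B(w)} = d/dw e^{x B(w)}, with D acting on the       *)
(* coefficients of the powers of w.                                           *)
Definition shifts_exp_xB (D : {poly F} -> {poly F}) : Prop :=
  linear D /\ forall n, D (exp_xB n) = fps_deriv exp_xB n.

Definition is_umbral_shift (D : {poly F} -> {poly F}) : Prop :=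
  unique shifts_exp_xB D.

End UmbralShift.

Section Fock.
Variable F : fieldType.

(* F[y, x_1, x_2, ...]: the variable of index 0 is y, that of index j >= 1 is *)
(* x_j.  The operators below are defined on this whole algebra; each of them  *)
(* preserves the subspace y F[x_1, x_2, ...], and only their action on it is  *)
(* used.                                                                      *)
Local Notation yx_alg := {malg F[{cmonom nat}]}.

Definition var (j : nat) : yx_alg := << ucm j >>.

Definition yvar : yx_alg := var 0.

Definition pderiv (j : nat) (p : yx_alg) : yx_alg :=
  \sum_(m <- msupp p) << p@_m *+ m j *g divcm m (ucm j) >>.

(* The index Negz k stands for n = - k.+1, so that - n - 1 = k and            *)
(* x_(- n) = x_(k.+1).                                                        *)
Definition h (n : int) (p : yx_alg) : yx_alg :=
  match n with
  | Posz 0 => yvar * pderiv 0 p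
  | Posz k => k`!%:R *: pderiv k p
  | Negz k => (k`!%:R)^-1 *: (var k.+1 * p)
  end.

(* For each p all but finitely many terms of the sum vanish.                  *)
Definition Lm1 (p : yx_alg) : yx_alg :=
  2%:R^-1 *: \sum_(k \in [set: int]) h (- 1 - k) (h k p).

Definition phi (B : nat -> F) : yx_alg -> {poly F} :=
  mmap (@polyC F) (fun m : {cmonom nat} =>
    \prod_(j <- finsupp m) (if j is 0 then 1 else B j *: 'X) ^+ m j).

End Fock.

(* Main.v *)
From HB Require Import structures.
Require Import Defs.
From mathcomp Require Import all_boot all_order all_algebra.
From mathcomp Require Import finmap.
From mathcomp Require Import boolp classical_sets functions cardinality fsbigop.
From mathcomp Require Import monalg.
From mathcomp Require Import reals complex zify ring.

Set Implicit Arguments.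
Unset Strict Implicit.
Unset Printing Implicit Defensive.

Import GRing.Theory.
Local Open Scope ring_scope.

(** Put [A_n = phi_B (L(-1)^n y)] and [e_n = [w^n] e^(x B(w))].  On the Fock space
    [L(-1)] is the derivation [x_1 y d/dy + sum_k x_(k+1) d/dx_k], so that the
    Leibniz rule applied to [L(-1)^n (x_1 y)] gives
    [A_(n+1) = x sum_k C(n,k) B_(k+1) A_(n-k)].  The identity
    [d/dw e^(x B(w)) = x B'(w) e^(x B(w))] is the same recursion for [n! e_n], whence
    [A_n = n! e_n].  As [B_1 <> 0], [e_n] has degree exactly [n], so the [e_n] form a
    basis of the polynomials: a linear map is determined, and can be prescribed, by
    its values on either family, and the two sets of conditions agree. *)

(** * Linear maps prescribed on a family of polynomials with one member in each degree *)

Section PolyBasis.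
Variables (F : fieldType) (V : lmodType F) (A : nat -> {poly F}).
Hypothesis sizeA : forall n, size (A n) = n.+1.

Let quot n (p : {poly F}) : F := p`_n / lead_coef (A n).

(** The expansion of [p] along [A], peeled off from the top degree. Here [n] serves as fuel, and the
    whole of [p] is expanded once [size p <= n]. *)
Fixpoint extend_basis (C : nat -> V) (n : nat) (p : {poly F}) : V :=
  if n is m.+1 then
    extend_basis C m (p - quot m p *: A m) + quot m p *: C m
  else 0.

Let lead_coefA n : lead_coef (A n) != 0.
Proof. by rewrite lead_coef_eq0 -size_poly_eq0 sizeA. Qed.

Let size_reduce n (p : {poly F}) :
  (size p <= n.+1 -> size (p - quot n p *: A n)%R <= n)%N.
Proof.
move=> sp; apply/leq_sizeP => j; rewrite leq_eqVlt => /orP[/eqP <-|nj].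
  rewrite coefB coefZ (_ : (A n)`_n = lead_coef (A n)) ?divfK ?subrr //.
  by rewrite lead_coefE sizeA.
by rewrite coefB coefZ !nth_default ?mulr0 ?subr0 ?sizeA // (leq_trans sp).
Qed.

Lemma extend_basis_linear C n : linear (extend_basis C n).
Proof.
elim: n => [|n IHn] a p q /=; first by rewrite scaler0 addr0.
have qD : quot n (a *: p + q) = a * quot n p + quot n q.
  by rewrite /quot coefD coefZ mulrDl mulrA.
rewrite qD; move: (quot n p) (quot n q) => u v.
rewrite !scalerDl opprD addrACA -!scalerA -scalerBr IHn.
by rewrite scalerDr addrACA.
Qed.

Lemma extend_basis0 C n : extend_basis C n 0 = 0.
Proof.
have := @extend_basis_linear C n (-1) 0 0.
by rewrite scaler0 addr0 scaleN1r addNr.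
Qed.

(** Quotients at degrees beyond [p] vanish. Polynomials of different sizes can thus be given the
    same fuel, and for fixed fuel the expansion is linear. *)
Lemma extend_basis_stable C m n (p : {poly F}) :
  (size p <= n <= m)%N -> extend_basis C m p = extend_basis C n p.
Proof.
case/andP=> sp /subnK <-; elim: (m - n)%N => //= k IHk.
have -> : quot (k + n) p = 0.
  by rewrite /quot nth_default ?mul0r // (leq_trans sp) ?leq_addl.
by rewrite !scale0r subr0 addr0.
Qed.

Lemma linear_extension (C : nat -> V) :
  exists D : {poly F} -> V, linear D /\ forall n, D (A n) = C n.
Proof.
exists (fun p : {poly F} => extend_basis C (size p) p); split=> [a p q|n].
  pose N := maxn (size p) (maxn (size q) (size (a *: p + q))).
  have E (r : {poly F}) : (size r <= N)%N -> extend_basis C (size r) r = extend_basis C N r.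
    by move=> rN; rewrite (@extend_basis_stable C N (size r)) ?leqnn.
  by rewrite !E ?extend_basis_linear // /N !leq_max leqnn ?orbT.
rewrite sizeA /=.
have -> : quot n (A n) = 1.
  by rewrite /quot -[X in _`_X]/(n.+1.-1) -(sizeA n) -lead_coefE divff.
by rewrite !scale1r subrr extend_basis0 add0r.
Qed.

Lemma linear_basis_eq (D E : {poly F} -> V) :
  linear D -> linear E -> (forall n, D (A n) = E (A n)) -> D =1 E.
Proof.
move=> linD linE DE p; have [n] := ubnP (size p); elim: n p => // n IHn p.
rewrite ltnS => sp; case: n sp IHn => [|n] sp IHn.
  (* The zero polynomial is written through [A 0] so that linearity, in the form [a *: p + q],
     applies to it directly. *)
  have -> : p = (-1) *: A 0%N + A 0%N.
    by move: sp; rewrite leqn0 size_poly_eq0 scaleN1r addNr => /eqP.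
  by rewrite linD linE !DE.
have -> : p = quot n p *: A n + (p - quot n p *: A n) by rewrite addrC subrK.
by rewrite linD linE DE IHn // ltnS size_reduce.
Qed.

End PolyBasis.

(** * Coefficients of the series e^(x B(w)) *)

Section ExpSeries.
Variables (F : fieldType) (B : nat -> F).
Hypothesis charF : [pchar F] =i pred0.

Let natF_neq0 n : (n > 0)%N -> n%:R != 0 :> F.
Proof. by rewrite lt0n; have /pcharf0P -> := charF. Qed.

Definition truncate (N : nat) (f : nat -> F) : {poly F} := \poly_(i < N) f i.

(** The coefficient of w^n in a power involves only the coefficients of [f] up to [n]. This moves
    computations to polynomials, where the derivative of a power is available. *)
Lemma truncate_fps_exp (f : nat -> F) N k n :
  (n < N)%N -> fps_exp f k n = (truncate N f ^+ k)`_n.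
Proof.
elim: k n => [|k IHk] n nN; first by rewrite expr0 coef1.
rewrite exprS coefM /= /fps_mul; apply: eq_bigr => i _.
have iN : (i < N)%N by rewrite (leq_trans (ltn_ord i)).
by rewrite coef_poly iN IHk // (leq_ltn_trans (leq_subr _ _)).
Qed.

Lemma fps_exp_small (f : nat -> F) k n : f 0%N = 0 -> (n < k)%N -> fps_exp f k n = 0.
Proof.
move=> f0; elim: k n => // k IHk n nk; rewrite /= /fps_mul big1 // => i _.
case: i => [[|i] iP] /=; first by rewrite f0 mul0r.
by rewrite IHk ?mulr0 //; move: iP nk; lia.
Qed.

Lemma coef_exp_xB n k : (exp_xB B n)`_k = fps_exp (Bser B) k n / k`!%:R.
Proof.
rewrite /exp_xB (@fsbigE _ _ _ _ _ (iota 0 n.+1)) ?iota_uniq //; last first.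
  move=> i _; rewrite mem_iota /= add0n ltnS -ltnNge => ni.
  by rewrite fps_exp_small // mul0r scale0r.
rewrite big_mkcond (eq_bigr (fun i => (fps_exp (Bser B) i n / i`!%:R) *: 'X^i)).
  rewrite -/(index_iota 0 n.+1) big_mkord -(poly_def n.+1 (fun i => fps_exp (Bser B) i n / i`!%:R)) coef_poly.
  by case: ltnP => // nk; rewrite fps_exp_small // mul0r.
by move=> i _; rewrite in_setT.
Qed.

Lemma exp_xB0 : exp_xB B 0 = 1.
Proof.
apply/polyP => k; rewrite coef_exp_xB coef1.
case: k => [|k]; first by rewrite /= /fps_one divr1.
by rewrite fps_exp_small // mul0r.
Qed.

(* Comparison of coefficients in d/dw e^{x B(w)} = x B'(w) e^{x B(w)}. *)
Lemma exp_xB_rec n :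
  exp_xB B n.+1 *+ n.+1 =
  'X * \sum_(i < n.+1) (B i.+1 / i`!%:R) *: exp_xB B (n - i).
Proof.
apply/polyP => k; rewrite coefMn coef_exp_xB coefXM.
case: k => [|k]; first by rewrite /= /fps_one mul0r mul0rn.
(* Degree n+1 must survive the truncation, since the coefficient of w^n in the derivative of
   [P ^+ k.+1] comes from it. *)
pose P := truncate n.+2 (Bser B).
rewrite (@truncate_fps_exp _ n.+2) // -/P -mulrnAl -coef_deriv.
rewrite deriv_exp /= coefMn coefM coef_sum -[_ *+ k.+1]mulr_natr -mulrA mulr_suml.
apply: eq_bigr => -[i iP] _ /=; rewrite coefZ coef_exp_xB coef_deriv coef_poly.
rewrite (@truncate_fps_exp _ n.+2) ?(leq_ltn_trans (leq_subr _ _)) // -/P.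
rewrite ltnS iP /Bser -[_ *+ i.+1]mulr_natr !factS !natrM.
by field; rewrite !nat1r !natF_neq0 ?fact_gt0.
Qed.
End ExpSeries.

(** * First-order differential operators with finitely many active terms on each argument *)

Section FirstOrderOperator.
Variables (A : comNzRingType) (x c : nat -> A) (d : nat -> {additive A -> A}).
Hypothesis d_varM :
  forall j i p, d j (x i * p) = p *+ (i == j) + x i * d j p.
Hypothesis d_finite : forall p, exists N, forall j, (N <= j)%N -> d j p = 0.
Variable L : A -> A.
Hypothesis LE : forall p N, (forall j, (N <= j)%N -> d j p = 0) ->
  L p = \sum_(j < N) c j * d j p.

(** The formula [LE] allows any sufficiently large bound, so one bound common to [p] and [q] puts
    all the sums over the same range. *)
Lemma diffop_additive : zmod_morphism L.
Proof.
move=> p q; have [M pM] := d_finite p; have [N qN] := d_finite q.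
have le (z : nat) : (maxn M N <= z)%N -> (M <= z)%N /\ (N <= z)%N.
  by rewrite geq_max => /andP.
rewrite !(@LE _ (maxn M N)) => [|j /le[_ /qN] //|j /le[/pM] //|j /le[Mj Nj]].
  by rewrite -sumrB; apply: eq_bigr => j _; rewrite raddfB mulrBr.
by rewrite raddfB /= pM // qN // subr0.
Qed.

Lemma diffop_varM i p : L (x i * p) = c i * p + x i * L p.
Proof.
(* The bound must also exceed [i], because [d i] may be nonzero on [x i * p] even if it kills
   [p]. *)
have [M pM] := d_finite p; pose N := maxn i.+1 M.
have iN : (i < N)%N by rewrite leq_maxl.
have pN j : (N <= j)%N -> d j p = 0.
  by move=> Nj; rewrite pM // (leq_trans _ Nj) ?leq_maxr.
rewrite !(@LE _ N) => [|//|j Nj]; last first.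
  by rewrite d_varM pN // mulr0 addr0 ltn_eqF ?mulr0n // (leq_trans iN).
rewrite mulr_sumr; under eq_bigr do rewrite d_varM mulrDr mulrCA.
rewrite big_split /= (bigD1 (Ordinal iN)) //= eqxx mulr1n big1 ?addr0 // => j ji.
rewrite (_ : i == j = false) ?mulr0n ?mulr0 //.
by apply: contraNF ji => /eqP ij; apply/eqP/val_inj.
Qed.

End FirstOrderOperator.

Lemma scale_half_double (F : fieldType) (V : lmodType F) (v : V) :
  2%:R != 0 :> F -> 2%:R^-1 *: (v + v) = v.
Proof. by move=> ?; rewrite -mulr2n -scaler_nat scalerA mulVf ?scale1r. Qed.

(** In L(-1) the terms of index j and -1-j coincide; folding the sum produces the factor 2 that
    cancels 1/2. *)
Lemma fsbig_int_fold (V : zmodType) (t : int -> V) (u : nat -> V) N :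
  (forall j, t (Posz j) = u j) -> (forall j, t (Negz j) = u j) ->
  (forall j, (N <= j)%N -> u j = 0) ->
  \sum_(k \in [set: int]) t k = \sum_(j < N) u j + \sum_(j < N) u j.
Proof.
move=> tP tN u0.
pose r := [seq Posz j | j <- index_iota 0 N] ++ [seq Negz j | j <- index_iota 0 N].
rewrite (@fsbigE _ _ _ _ _ r) //; last 2 first.
- rewrite cat_uniq !map_inj_uniq ?iota_uniq // /= => [|? ? [] //|? ? [] //].
  by rewrite andbT; apply/hasPn => _ /mapP[i _ ->]; apply/mapP => -[].
- move=> [j|j] _; rewrite mem_cat => /norP[jP jN].
    rewrite tP u0 // leqNgt; apply: contra jP => jN'.
    by rewrite map_f // mem_index_iota.
  rewrite tN u0 // leqNgt; apply: contra jN => jN'.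
  by rewrite map_f // mem_index_iota.
rewrite big_mkcond (eq_bigr t) => [|k _]; last by rewrite in_setT.
rewrite big_cat !big_map !big_mkord.
by congr (_ + _); apply: eq_bigr.
Qed.

(** * Monomials and additive maps in a monoid algebra *)

Section Malg.
Variables (K : conomType) (R : comNzRingType).

Lemma malgUM (c d : R) (m n : K) :
  << c *g m >> * << d *g n >> = << c * d *g mmul m n >> :> {malg R[K]}.
Proof. exact: fgmulUU. Qed.

Lemma malgZU (c d : R) (m : K) :
  c *: << d *g m >> = << c * d *g m >> :> {malg R[K]}.
Proof. by apply/malgP => k; rewrite mcoeffZ !mcoeffU mulrnAr. Qed.

Lemma malg_scaleKr (c d : R) (p q : {malg R[K]}) :
  c * d = 1 -> c *: (p * (d *: q)) = p * q.
Proof. by move=> cd1; rewrite -scalerAr scalerA cd1 scale1r. Qed.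

Lemma malg_mulCA (p q r : {malg R[K]}) : p * (q * r) = q * p * r.
Proof. by rewrite mulrA [p * q]mulrC. Qed.

Lemma malg_additive_eq (V : zmodType) (f g : {malg R[K]} -> V) :
  zmod_morphism f -> zmod_morphism g ->
  (forall c m, f << c *g m >> = g << c *g m >>) -> f =1 g.
Proof.
move=> fB gB fg p.
pose fM := GRing.isZmodMorphism.Build _ _ f fB.
pose gM := GRing.isZmodMorphism.Build _ _ g gB.
pose fA : {additive {malg R[K]} -> V} := HB.pack f fM.
pose gA : {additive {malg R[K]} -> V} := HB.pack g gM.
rewrite -[f]/(fA : _ -> _) -[g]/(gA : _ -> _) [p]monalgE !raddf_sum.
by apply: eq_bigr => m _; apply: fg.
Qed.

End Malg.

(** * Partial derivatives and L(-1) on the Fock space *)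

Section Fock.
Variable F : fieldType.
Local Notation yx_alg := {malg F[{cmonom nat}]}.
Implicit Types p q : yx_alg.

(** The sum defining [pderiv] ranges over a support depending on [p]; as an [mmap], it inherits
    additivity. *)
Lemma pderivE j : @pderiv F j =
  mmap malgC (fun m => << (m j)%:R *g divcm m (ucm j) >>).
Proof.
apply/funext => p; rewrite /pderiv /mmap; apply: eq_bigr => m _.
by rewrite malgUM mul1m mulr_natr.
Qed.

Lemma pderiv_additive j : zmod_morphism (@pderiv F j).
Proof. by move=> p q; rewrite pderivE raddfB. Qed.

HB.instance Definition _ j :=
  GRing.isZmodMorphism.Build yx_alg yx_alg (@pderiv F j) (pderiv_additive j).

Lemma ucmM_div (m : {cmonom nat}) i j : m j != 0%N ->
  divcm (mmul (ucm i) m) (ucm j) = mmul (ucm i) (divcm m (ucm j)).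
Proof.
move=> mj; apply/eqP/cmP => k; rewrite divcmE !cmM !divcmE !ucmE.
by case: (eqVneq j k) mj => [->|_]; lia.
Qed.

Lemma ucmKM (m : {cmonom nat}) i : divcm (mmul (ucm i) m) (ucm i) = m.
Proof. by apply/eqP/cmP => k; rewrite divcmE cmM addKn. Qed.

Lemma ucm_divK (m : {cmonom nat}) i : m i != 0%N ->
  mmul (ucm i) (divcm m (ucm i)) = m.
Proof. by move=> mi; rewrite -ucmM_div ?ucmKM. Qed.

Definition monom (c : F) (m : {cmonom nat}) : yx_alg := << c *g m >>.

Lemma monom_additive_eq (V : zmodType) (f g : yx_alg -> V) :
  zmod_morphism f -> zmod_morphism g ->
  (forall c m, f (monom c m) = g (monom c m)) -> f =1 g.
Proof. exact: malg_additive_eq. Qed.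

Lemma monom0 m : monom 0 m = 0.
Proof. exact: monalgU0. Qed.

Lemma monomD c d m : monom (c + d) m = monom c m + monom d m.
Proof. exact: monalgUD. Qed.

Lemma varM_monom i c (m : {cmonom nat}) :
  var F i * monom c m = monom c (mmul (ucm i) m).
Proof. by rewrite /var malgUM mul1r. Qed.

Lemma scale_monom a c m : a *: monom c m = monom (a * c) m.
Proof. exact: malgZU. Qed.

Lemma pderiv_monom j c (m : {cmonom nat}) :
  pderiv j (monom c m) = monom (c *+ m j) (divcm m (ucm j)).
Proof. by rewrite pderivE mmapU malgUM mul1m mulr_natr. Qed.

Lemma pderiv_varM j i p :
  pderiv j (var F i * p) = p *+ (i == j) + var F i * pderiv j p.
Proof.
move: p; apply: monom_additive_eq => [p q|p q|c m].
- by rewrite mulrBr raddfB.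
- by rewrite raddfB mulrnBl mulrBr opprD addrACA.
rewrite varM_monom [LHS]pderiv_monom pderiv_monom varM_monom cmM ucmE.
(* Exponents are subtracted with truncation at 0, so division by x_j is not exact when x_j is absent
   from [m]; that term then has coefficient 0. *)
case: (eqVneq (m j) 0%N) => [->|mj].
  rewrite mulr0n monom0 addr0 addn0.
  by case: (eqVneq i j) => [<-|_]; rewrite ?ucmKM // !mulr0n monom0.
rewrite mulrnDr monomD ucmM_div //; congr (_ + _).
case: (eqVneq i j) mj => [<- mi|_ _]; last by rewrite !mulr0n monom0.
by rewrite ucm_divK.
Qed.

Lemma pderivZ j c p : pderiv j (c *: p) = c *: pderiv j p.
Proof.
move: p; apply: monom_additive_eq => [p q|p q|d m].
- by rewrite scalerBr raddfB.
- by rewrite raddfB scalerBr.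
by rewrite scale_monom [LHS]pderiv_monom pderiv_monom scale_monom mulrnAr.
Qed.

Lemma pderiv_finite p : exists N, forall j, (N <= j)%N -> pderiv j p = 0.
Proof.
rewrite [p]monalgE; apply: (big_ind
  (fun q => exists N, forall j, (N <= j)%N -> pderiv j q = 0)) => [|q r [M qM] [N rN]|m _].
- by exists 0%N => j _; rewrite raddf0.
- exists (maxn M N) => j; rewrite geq_max => /andP[Mj Nj].
  by rewrite raddfD /= qM // rN // addr0.
exists (\max_(i <- finsupp m) i.+1)%N => j mj.
rewrite -/(monom _ m) pderiv_monom (_ : m j = 0%N) ?mulr0n ?monom0 //.
apply/eqP; rewrite cmE_eq0; apply: contraTN mj => jm.
by rewrite -ltnNge (leq_trans _ (leq_bigmax_seq _ jm _)).
Qed.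

(* The image of the variable of index j under the derivation L(-1). *)
Definition Lvar (j : nat) : yx_alg :=
  if j is 0 then var F 1 * yvar F else var F j.+1.

Hypothesis charF : [pchar F] =i pred0.

Lemma Lm1_termP j p : h (- 1 - Posz j) (h (Posz j) p) = Lvar j * pderiv j p.
Proof.
have nz : j`!%:R != 0 :> F by have /pcharf0P -> := charF; rewrite -lt0n fact_gt0.
case: j nz => [|j] nz.
  by rewrite /= invr1 scale1r mulrA.
rewrite (_ : - 1 - Posz j.+1 = Negz j.+1); last by rewrite !NegzE; lia.
exact/malg_scaleKr/mulVf.
Qed.

(** Here the derivative in x_j acts after multiplication by x_(j+1). The two commute since the
    indices differ, and the factorials cancel. *)
Lemma Lm1_termN j p : h (- 1 - Negz j) (h (Negz j) p) = Lvar j * pderiv j p.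
Proof.
have nz : j`!%:R != 0 :> F by have /pcharf0P -> := charF; rewrite -lt0n fact_gt0.
rewrite (_ : - 1 - Negz j = Posz j); last by rewrite NegzE; lia.
case: j nz => [|j] nz.
  by rewrite /= invr1 scale1r pderiv_varM mulr0n add0r; apply: malg_mulCA.
rewrite /= pderivZ scalerA mulfV // scale1r pderiv_varM.
by rewrite (_ : _ == _ = false) ?mulr0n ?add0r //; lia.
Qed.

Lemma Lm1E p N : (forall j, (N <= j)%N -> pderiv j p = 0) ->
  Lm1 p = \sum_(j < N) Lvar j * pderiv j p.
Proof.
move=> pN; rewrite /Lm1.
have TP := Lm1_termP^~ p; have TN := Lm1_termN^~ p.
have u0 j : (N <= j)%N -> Lvar j * pderiv j p = 0 by move=> Nj; rewrite pN // mulr0.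
have E := @fsbig_int_fold yx_alg (fun k => h (- 1 - k) (h k p))
  (fun j => Lvar j * pderiv j p) N TP TN u0.
rewrite E.
by apply: scale_half_double; have /pcharf0P -> := charF.
Qed.

Lemma Lm1_additive : zmod_morphism (@Lm1 F).
Proof. exact: (diffop_additive pderiv_finite Lm1E). Qed.

Lemma Lm1_varM i p : Lm1 (var F i * p) = Lvar i * p + var F i * Lm1 p.
Proof. exact: (diffop_varM pderiv_varM pderiv_finite Lm1E). Qed.

Lemma Lm1_yvar : Lm1 (yvar F) = var F 1 * yvar F.
Proof.
have L1 : Lm1 1 = 0 :> yx_alg.
  rewrite (@Lm1E _ 0) ?big_ord0 // => j _.
  by rewrite -[1]/(monom 1 mone) pderiv_monom cm1 mulr0n monom0.
have E (a b : yx_alg) : a * 1 + b * 0 = a by rewrite mulr1 mulr0 addr0.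
(* Writing y as y times 1 makes the product rule applicable. *)
by rewrite -[LHS](congr1 _ (mulr1 _)) [LHS](Lm1_varM 0 1) L1; apply: E (Lvar 0) _.
Qed.

End Fock.

(** * Leibniz rule for iterates of an operator that shifts a family *)

Section Leibniz.
Variables (A : comNzRingType) (u : nat -> A) (L : A -> A).
Hypothesis L_additive : zmod_morphism L.
Hypothesis L_uM : forall i p, L (u i * p) = u i.+1 * p + u i * L p.

Let iterD n p q : iter n L (p + q) = iter n L p + iter n L q.
Proof.
have LB := L_additive; have L0 : L 0 = 0 by rewrite -[X in L X](subrr 0) LB subrr.
have LD r s : L (r + s) = L r + L s.
  by rewrite -[s in LHS]opprK LB -[- s]add0r LB L0 sub0r opprK.
by elim: n => //= n ->.
Qed.

(** The k-th iterate of the shift turns [u i] into [u (i + k)]. The index [i] varies in the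
    induction because one application of [L] already produces [u i.+1]. *)
Lemma iter_Leibniz n i p :
  iter n L (u i * p) = \sum_(k < n.+1) (u (i + k)%N * iter (n - k) L p) *+ 'C(n, k).
Proof.
elim: n i p => [|n IHn] i p; first by rewrite big_ord1 addn0 bin0 subn0.
rewrite iterSr L_uM iterD !IHn.
rewrite [in RHS]big_ord_recl addn0 !bin0 subn0 [LHS]addrC.
(* Pascal's rule splits the sum into the expansions of the iterates on [u i * L p] and on
   [u i.+1 * p]. *)
under [in RHS]eq_bigr do rewrite /= binS mulrnDr subSS.
rewrite big_split /= addrA; congr (_ + _); last first.
  by apply: eq_bigr => k _; rewrite addSnnS.
rewrite big_ord_recl addn0 subn0 bin0 -iterSr; congr (_ + _).
rewrite [in RHS]big_ord_recr /= bin_small // mulr0n addr0.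
by apply: eq_bigr => k _; rewrite /bump /= add1n -iterSr subnSK.
Qed.

End Leibniz.

(** * The substitution map as a ring morphism *)

Section Phi.
Variables (F : fieldType) (B : nat -> F).

Definition phi_var (j : nat) : {poly F} := if j is 0 then 1 else B j *: 'X.

Definition phi_monom (m : {cmonom nat}) : {poly F} :=
  \prod_(j <- finsupp m) phi_var j ^+ m j.

(** Variables outside the support contribute the factor 1. Two monomials and their product can thus
    be evaluated over one common set of variables. *)
Lemma phi_monomEw (m : {cmonom nat}) (d : {fset nat}) : (finsupp m `<=` d)%fset ->
  phi_monom m = \prod_(j <- d) phi_var j ^+ m j.
Proof.
move=> md; rewrite /phi_monom (big_fset_incl _ md) // => j _.
by rewrite -cmE_neq0 negbK => /eqP ->.
Qed.

Lemma phi_monom_mmorphism : mmorphism phi_monom.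
Proof.
split=> [m1 m2|]; last by rewrite /phi_monom mdom1 big_seq_fset0.
rewrite (phi_monomEw (fsubsetUl (finsupp m1) (finsupp m2))).
rewrite (phi_monomEw (fsubsetUr (finsupp m1) (finsupp m2))).
rewrite /phi_monom mdomD -big_split; apply: eq_bigr => j _.
by rewrite cmM exprD.
Qed.

HB.instance Definition _ :=
  isMultiplicative.Build {cmonom nat} {poly F} phi_monom phi_monom_mmorphism.

Lemma phiE : phi B = mmap (@polyC F) phi_monom.
Proof. by []. Qed.

Lemma phiM : {morph phi B : p q / p * q}.
Proof. by move=> p q; rewrite phiE rmorphM. Qed.

Lemma phi_sum n (f : 'I_n -> {malg F[{cmonom nat}]}) :
  phi B (\sum_(i < n) f i) = \sum_(i < n) phi B (f i).
Proof. by rewrite phiE raddf_sum. Qed.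

Lemma phiMn n p : phi B (p *+ n) = phi B p *+ n.
Proof. by rewrite phiE raddfMn. Qed.

Lemma phi_varE j : phi B (var F j) = phi_var j.
Proof.
by rewrite phiE mmapU mul1r /phi_monom mdomU big_seq_fset1 cmU eqxx.
Qed.

End Phi.

(** * Comparison of the Fock space family with the coefficients of e^(x B(w)) *)

Section UmbralShiftFock.
Variables (F : fieldType) (B : nat -> F).
Hypothesis charF : [pchar F] =i pred0.

Lemma Lm1_iter_rec n : iter n.+1 (@Lm1 F) (yvar F) =
  \sum_(k < n.+1) (var F k.+1 * iter (n - k) (@Lm1 F) (yvar F)) *+ 'C(n, k).
Proof.
have LuM i p : Lm1 (var F i.+1 * p) = var F i.+2 * p + var F i.+1 * Lm1 p.
  exact: (Lm1_varM charF i.+1 p).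
rewrite iterSr (Lm1_yvar charF).
(* The shifted family starts at x_1, because y, of index 0, goes to x_1 y and not to x_1. *)
exact: (@iter_Leibniz _ (fun i => var F i.+1) _ (Lm1_additive charF) LuM n 0).
Qed.

Lemma phi_Lm1_iter n :
  phi B (iter n (@Lm1 F) (yvar F)) = exp_xB B n *+ n`!.
Proof.
have [N] := ubnP n; elim: N n => // N IHN [|n] nN.
  by rewrite exp_xB0 /= phi_varE.
rewrite Lm1_iter_rec phi_sum factS mulrnA (exp_xB_rec _ charF) mulr_sumr -sumrMnl.
apply: eq_bigr => -[k kn] _ /=.
rewrite phiMn phiM phi_varE IHN /=; last by lia.
rewrite -!scaler_nat -!scalerAl -!scalerAr !scalerA; congr (_ *: _).
(* The two recursions match through n! = C(n,k) k! (n-k)!. *)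
rewrite -(bin_fact (_ : k <= n)%N) // !natrM.
have nz : k`!%:R != 0 :> F by have /pcharf0P -> := charF; rewrite -lt0n fact_gt0.
by field.
Qed.

(** The lowest term of B(w) is B_1 w, so only [i = 1] contributes to the product: the constant term
    is 0, and for larger [i] the other factor is taken below its order. *)
Lemma fps_exp_diag n : fps_exp (Bser B) n n = B 1%N ^+ n.
Proof.
elim: n => [|n IHn]; first by rewrite expr0.
rewrite /= /fps_mul !big_ord_recl /= mul0r add0r.
rewrite subSS subn0 IHn divr1 -exprS big1 ?addr0 // => i _.
rewrite fps_exp_small ?mulr0 // /bump /=; have := ltn_ord i; lia.
Qed.

(** The coefficient of x^n is B_1^n / n!; this is where B_1 being nonzero enters. *)
Lemma size_exp_xB n : B 1%N != 0 -> size (exp_xB B n) = n.+1.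
Proof.
move=> B1; apply/eqP; rewrite eqn_leq; apply/andP; split.
  by apply/leq_sizeP => k nk; rewrite coef_exp_xB // fps_exp_small ?mul0r.
rewrite ltnNge; apply/negP => /leq_sizeP/(_ n (leqnn n))/eqP.
rewrite coef_exp_xB // fps_exp_diag mulf_eq0 invr_eq0 expf_eq0 (negPf B1) andbF /=.
by have /pcharf0P -> := charF; rewrite -leqn0 leqNgt fact_gt0.
Qed.

End UmbralShiftFock.

Theorem theorem7p1 (R : realType) (B : nat -> R[i]) (hB1 : B 1%N != 0) :
  exists D : {poly R[i]} -> {poly R[i]},
    is_umbral_shift B D /\
    unique (fun E : {poly R[i]} -> {poly R[i]} =>
      linear E /\
      forall n : nat,
        E (phi B (iter n (@Lm1 R[i]) (yvar R[i]))) = phi B (iter n.+1 (@Lm1 R[i]) (yvar R[i]))) D.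
Proof.
have charC : [pchar R[i]] =i pred0 by apply: Num.Theory.pchar_num.
have size_exp n : size (exp_xB B n) = n.+1 by apply: size_exp_xB.
have [D [linD DE]] := linear_extension size_exp (fps_deriv (exp_xB B)).
exists D; split.
  split=> // E [linE EE]; apply/funext.
  by apply: (linear_basis_eq size_exp) => // n; rewrite DE EE.
have fact_neq0 n : n`!%:R != 0 :> R[i].
  by have /pcharf0P -> := charC; rewrite -lt0n fact_gt0.
(* For a linear [E] the two conditions at [n] differ by the invertible factor n!, since (n+1)!
   e_(n+1) is n! times the coefficient of w^n in the derivative. Existence and uniqueness both
   transfer. *)
have step (E : {poly R[i]} -> {poly R[i]}) n : linear E ->
    (E (phi B (iter n (@Lm1 R[i]) (yvar R[i]))) =
       phi B (iter n.+1 (@Lm1 R[i]) (yvar R[i]))) <->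
    E (exp_xB B n) = fps_deriv (exp_xB B) n.
  move=> linE; rewrite !phi_Lm1_iter // factS mulrnA -/(fps_deriv _ n).
  have E0 : E 0 = 0 by have := linE (-1) 0 0; rewrite scaler0 addr0 scaleN1r addNr.
  have EZ a p : E (a *: p) = a *: E p by rewrite -[a *: p]addr0 linE E0 addr0.
  rewrite -(scaler_nat n`! (exp_xB B n)) -(scaler_nat n`! (fps_deriv _ n)) EZ.
  by split=> [/(scalerI (fact_neq0 n))|->].
split=> [|E [linE EE]]; first by split=> // n; apply/step.
apply/funext/(linear_basis_eq size_exp) => // n.
by rewrite DE; apply/esym/step.
Qed.
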